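(* Let $X$ be a compact Hausdorff space and let $\varphi_{0,\infty}=\{\varphi_j\}_{j=0}^\infty$ be a sequence of upper semicontinuous multivalued maps $\varphi_j:X\to\mathcal{K}(X)$, $j\in\mathbb{N}\cup\{0\}$. Then $$h_\rho^{\mathrm{span}}(\varphi_{0,\infty})\le h_\rho^{\mathrm{sep}}(\varphi_{0,\infty})\le h_{\mathrm{H}}(\varphi_{0,\infty})\le h_{\mathfrak{i}}(\varphi_{0,\infty}).$$
   Context: $\mathcal{K}(X)$ is the set of nonempty compact subsets of $X$. A multivalued map $\varphi:X\to\mathcal{K}(X)$ is upper semicontinuous (u.s.c.) if $\{x\in X:\varphi(x)\subset B\}$ is open for every open $B\subset X$. Composition: $(\varphi_2\circ\varphi_1)(x)=\bigcup_{y\in\varphi_1(x)}\varphi_2(y)$; $\varphi^{[0]}=\mathrm{id}_X$ (i.e. $\varphi^{[0]}(x)=\{x\}$), $\varphi^{[k]}=\varphi_{k-1}\circ\dots\circ\varphi_0$ for $k>0$. For u.s.c. $\varphi_j:X\to\mathcal{K}(X)$ the sets $\varphi^{[k]}(x)$ are nonempty compact. $\mathbb{N}=\{1,2,\dots\}$. Uniformities. A uniformity on a nonempty set $X$ is a family $\mathcal{U}$ of pseudometrics on $X$ such that: (U1) $p_0,p_1\in\mathcal{U}$ implies $\max\{p_0,p_1\}\in\mathcal{U}$; (U2) if $p$ is a pseudometric on $X$ such that for every $\varepsilon>0$ there are $q\in\mathcal{U}$, $\delta>0$ with $q(x,y)<\delta\Rightarrow p(x,y)<\varepsilon$ for all $x,y\in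 X$, then $p\in\mathcal{U}$; (U3) for $x\ne y$ there is $p\in\mathcal{U}$ with $p(x,y)>0$. The balls $B_p(x,r)=\{y: p(x,y)<r\}$, $p\in\mathcal{U}$, $x\in X$, $r>0$, form a base of a Hausdorff topology. A compact Hausdorff space $X$ carries a unique uniformity $\mathcal{U}$ inducing its topology; this is the $\mathcal{U}$ used below. $h_\rho$: $p^\rho(A,B)=\inf\{p(a,b):a\in A,b\in B\}$. $S\subset X$ is $(p,\varepsilon,n)_\rho$-separated if for all distinct $x,y\in S$ there is $0\le k<n$ with $p^\rho(\varphi^{[k]}(x),\varphi^{[k]}(y))>\varepsilon$; $R\subset X$ is $(p,\varepsilon,n)_\rho$-spanning if for every $x\in X$ there is $y\in R$ with $p^\rho(\varphi^{[k]}(x),\varphi^{[k]}(y))\le\varepsilon$ for all $0\le k<n$. With $s_\rho(\varphi_{0,\infty},p,\varepsilon,n)$ the maximal cardinality of a $(p,\varepsilon,n)_\rho$-separated set and $r_\rho(\varphi_{0,\infty},p,\varepsilon,n)$ the least cardinality of a $(p,\varepsilon,n)_\rho$-spanning set, $h_\rho^{\mathrm{sep}}(\varphi_{0,\infty})=\sup_{p\in\mathcal{U},\varepsilon>0}\limsup_n\frac1n\log s_\rho$ and $h_\rho^{\mathrm{span}}(\varphi_{0,\infty})=\sup_{p\in\mathcal{U},\varepsilon>0}\limsup_n\frac1n\log r_\rho$. $h_{\mathrm{H}}$: for $A,B\in\mathcal{K}(X)$ let $p^{\mathrm{H}}(A,B)=\max\{\sup_{a\in A}\inf_{b\in B}p(a,b),\sup_{b\in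 B}\inf_{a\in A}p(a,b)\}$. Let $s_{\mathrm{H}}(\varphi_{0,\infty},p,\varepsilon,n)$ be the largest cardinality of a set $S\subset X$ such that for all distinct $x,y\in S$ there is $0\le k<n$ with $p^{\mathrm{H}}(\varphi^{[k]}(x),\varphi^{[k]}(y))>\varepsilon$. Then $h_{\mathrm{H}}(\varphi_{0,\infty})=\sup_{p\in\mathcal{U},\varepsilon>0}\limsup_n\frac1n\log s_{\mathrm{H}}(\varphi_{0,\infty},p,\varepsilon,n)$. (The same value is obtained with the least cardinality of $R\subset X$ such that for every $x\in X$ there is $y\in R$ with $p^{\mathrm{H}}(\varphi^{[k]}(x),\varphi^{[k]}(y))\le\varepsilon$ for all $0\le k<n$.) $h_{\mathfrak{i}}$ (parametric branch entropy): $\mathrm{Orb}_n(\varphi_{0,\infty},x)$ is the set of $(x_0,\dots,x_{n-1})\in X^n$ with $x_0=x$ and $x_{i+1}\in\varphi_i(x_i)$ for $0\le i\le n-2$. With $p_n(\bar x,\bar y)=\max_{0\le i\le n-1}p(\bar x_i,\bar y_i)$ on $X^n$, let $p_n^b(x,y)$ be the Hausdorff pseudodistance with respect to $p_n$ between $\mathrm{Orb}_n(\varphi_{0,\infty},x)$ and $\mathrm{Orb}_n(\varphi_{0,\infty},y)$, i.e. $p_n^b(x,y)=\max\{\sup_{\bar x}\inf_{\bar y}p_n(\bar x,\bar y),\sup_{\bar y}\inf_{\bar x}p_n(\bar x,\bar y)\}$ where $\bar x\in\mathrm{Orb}_n(\varphi_{0,\infty},x)$, $\bar y\in\mathrm{Orb}_n(\varphi_{0,\infty},y)$.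 Let $s_{\mathfrak{i}}(\varphi_{0,\infty},p_n^b,\varepsilon)$ be the largest cardinality of $S\subset X$ with $p_n^b(x,y)>\varepsilon$ for all distinct $x,y\in S$. Then $h_{\mathfrak{i}}(\varphi_{0,\infty})=\sup_{p\in\mathcal{U},\varepsilon>0}\limsup_n\frac1n\log s_{\mathfrak{i}}(\varphi_{0,\infty},p_n^b,\varepsilon)$ (equivalently, with the smallest cardinality of a set $R\subset X$ such that each $y\in X$ has $x\in R$ with $p_n^b(x,y)\le\varepsilon$). *)

(* Defs.v *)
From mathcomp Require Import all_boot all_order all_algebra.
From mathcomp Require Import all_classical all_reals all_analysis.

Set Implicit Arguments.
Unset Strict Implicit.
Unset Printing Implicit Defensive.

Import Order.TTheory GRing.Theory Num.Theory.

Local Open Scope classical_set_scope.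
Local Open Scope ring_scope.

Section Uniformities.
Variables (R : realType) (X : Type).

Definition pseudometric (p : X -> X -> R) : Prop :=
  [/\ forall x y, 0 <= p x y,
      forall x, p x x = 0,
      forall x y, p x y = p y x
    & forall x y z, p x z <= p x y + p y z].

Definition pball (p : X -> X -> R) (x : X) (r : R) : set X :=
  [set y | p x y < r].

Record uniformity (U : set (X -> X -> R)) : Prop := Uniformity {
  uniformity_nonempty : [set: X] !=set0 ;
  uniformity_pseudometric : forall p, U p -> pseudometric p ;
  uniformity_max : forall p q, U p -> U q ->
    U (fun x y => Num.max (p x y) (q x y)) ;
  uniformity_saturated : forall p, pseudometric p ->
    (forall e, 0 < e -> exists q d,
      [/\ U q, 0 < d & forall x y, q x y < d -> p x y < e]) -> U p ;
  uniformity_separating : forall x y, x <> y -> exists2 p, U p & 0 < p x y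
}.

End Uniformities.

Definition induces_topology (R : realType) (X : topologicalType)
    (U : set (X -> X -> R)) : Prop :=
  basis [set B : set X | exists p x r, [/\ U p, 0 < r & B = pball p x r]].

Section MultivaluedMaps.
Variable X : topologicalType.

Definition nonempty_compact (A : set X) : Prop := A !=set0 /\ compact A.

Definition upper_semicontinuous (f : X -> set X) : Prop :=
  forall B : set X, open B -> open [set x | f x `<=` B].

End MultivaluedMaps.

Section Distances.
Variables (R : realType) (T : Type) (d : T -> T -> R).
Implicit Types A B : set T.

(* Infima and suprema are taken in [\bar R], so that no default value for the
   supremum of an unbounded set can enter the definitions. *)
Definition dist_rho A B : \bar R :=
  ereal_inf [set (d a b)%:E | a in A & b in B].

Definition dist_hausdorff A B : \bar R :=
  maxe (ereal_sup [set ereal_inf [set (d a b)%:E | b in B] | a in A])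
       (ereal_sup [set ereal_inf [set (d a b)%:E | a in A] | b in B]).

End Distances.

Section Dynamics.
Variables (X : Type) (phi : nat -> X -> set X).

Fixpoint mv_iter (k : nat) (x : X) : set X :=
  if k is j.+1 then \bigcup_(y in mv_iter j x) phi j y else [set x].

(* Points of X^n are functions ['I_n -> X]. *)
Definition orbits (n : nat) (x : X) : set ('I_n -> X) :=
  [set u | (forall i : 'I_n, i = 0%N :> nat -> u i = x) /\
           (forall i j : 'I_n, j = i.+1 :> nat -> phi i (u i) (u j))].

End Dynamics.

(* The pseudometrics to which this is applied are nonnegative, so 0 is a
   neutral initial value for the maximum. *)
Definition prod_dist (R : realType) (X : Type) (p : X -> X -> R) (n : nat)
    (u v : 'I_n -> X) : R :=
  \big[Num.max/0]_(i < n) p (u i) (v i).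

Section Entropies.
Variables (R : realType) (X : choiceType).
Variables (U : set (X -> X -> R)) (phi : nat -> X -> set X).
Implicit Types (p : X -> X -> R) (e : R) (n : nat).

Local Open Scope ereal_scope.

(* The term at n = 0 is a junk value, irrelevant for the upper limit. *)
Definition growth_rate (c : nat -> \bar R) : \bar R :=
  limn_esup (fun n => (n%:R^-1)%:E * lne (c n)).

Definition entropy_of (c : (X -> X -> R) -> R -> nat -> \bar R) : \bar R :=
  ereal_sup [set growth_rate (c p e) | p in U & e in [set e : R | (0 < e)%R]].

Definition separated_rho p e n (S : set X) : Prop :=
  forall x y, S x -> S y -> x <> y ->
  exists k, (k < n)%N /\ e%:E < dist_rho p (mv_iter phi k x) (mv_iter phi k y).

Definition spanning_rho p e n (S : set X) : Prop :=
  forall x, exists y, S y /\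
  forall k, (k < n)%N -> dist_rho p (mv_iter phi k x) (mv_iter phi k y) <= e%:E.

Definition separated_H p e n (S : set X) : Prop :=
  forall x y, S x -> S y -> x <> y ->
  exists k, (k < n)%N /\
    e%:E < dist_hausdorff p (mv_iter phi k x) (mv_iter phi k y).

Definition branch_dist p n (x y : X) : \bar R :=
  dist_hausdorff (@prod_dist R X p n) (orbits phi x) (orbits phi y).

Definition separated_branch p e n (S : set X) : Prop :=
  forall x y, S x -> S y -> x <> y -> e%:E < branch_dist p n x y.

(* [counting S] is the cardinality of S, with value +oo for infinite S. *)
Definition s_rho p e n : \bar R :=
  ereal_sup [set counting S | S in separated_rho p e n].

Definition r_rho p e n : \bar R :=
  ereal_inf [set counting S | S in spanning_rho p e n].

Definition s_H p e n : \bar R :=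
  ereal_sup [set counting S | S in separated_H p e n].

Definition s_branch p e n : \bar R :=
  ereal_sup [set counting S | S in separated_branch p e n].

Definition h_rho_sep : \bar R := entropy_of s_rho.
Definition h_rho_span : \bar R := entropy_of r_rho.
Definition h_H : \bar R := entropy_of s_H.
Definition h_branch : \bar R := entropy_of s_branch.

End Entropies.

(* Main.v *)
Require Import Defs.
From mathcomp Require Import all_boot all_order all_algebra.
From mathcomp Require Import all_classical all_reals all_analysis.

(** All three inequalities hold already for the counting functions, for each
fixed pseudometric [p], each [e > 0] and each [n]; the entropies then compare
because [limsup] and [sup] are monotone ([entropy_of_le]).

- By Zorn's lemma there is a maximal separated set, and by maximality it is
  spanning, whence [r_rho <= s_rho].  This does not need the separated sets to
  have bounded cardinality.
- For nonempty sets the infimum distance is at most the Hausdorff distance, so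
  a set separated for the former is separated for the latter, whence
  [s_rho <= s_H].
- The k-th iterate at [x] is the set of k-th coordinates of the orbits of
  length [n > k] starting from [x], because every finite orbit can be continued.
  The coordinate projection does not increase distances, so it does not
  increase Hausdorff distances either; thus each Hausdorff distance between
  iterates is at most the branch distance, whence [s_H <= s_branch]. *)

Import Order.TTheory GRing.Theory Num.Theory.

Local Open Scope classical_set_scope.
Local Open Scope ereal_scope.

(** * Monotonicity of growth rates and entropies *)

Lemma limn_esup_le (R : realType) (u v : (\bar R)^nat) :
  (forall n, u n <= v n) -> limn_esup u <= limn_esup v.
Proof.
move=> uv; rewrite /limn_esup /limf_esup.
apply/ereal_infP => _ [V FV <-].
apply: ge_ereal_inf; exists (ereal_sup [set u x | x in V]); first by exists V.
apply/ereal_supP => _ [n Vn <-].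
by apply: le_ereal_sup_tmp; exists (v n) => //; exists n.
Qed.

Lemma growth_rate_le (R : realType) (c d : nat -> \bar R) :
  (forall n, 0 <= c n) -> (forall n, c n <= d n) ->
  growth_rate c <= growth_rate d.
Proof.
move=> c0 cd; apply: limn_esup_le => n.
apply: lee_wpmul2l; first by rewrite lee_fin invr_ge0 ler0n.
by rewrite lee_lne ?in_itv/= ?leey ?andbT ?(le_trans (c0 n)).
Qed.

Lemma entropy_of_le (R : realType) (X : choiceType) (U : set (X -> X -> R))
    (c d : (X -> X -> R) -> R -> nat -> \bar R) :
  (forall p e n, U p -> (0 < e)%R -> 0 <= c p e n) ->
  (forall p e n, U p -> (0 < e)%R -> c p e n <= d p e n) ->
  entropy_of U c <= entropy_of U d.
Proof.
move=> c0 cd; apply/ereal_supP => _ [p Up [e e0 <-]].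
apply: le_ereal_sup_tmp; exists (growth_rate (d p e)).
  by exists p => //; exists e.
by apply: growth_rate_le => n; [exact: c0|exact: cd].
Qed.

Lemma counting_ge0 (R : realType) (T : choiceType) (S : set T) :
  0 <= counting S :> \bar R.
Proof. by rewrite /counting; case: ifP => _; rewrite ?leey ?lee_fin ?ler0n. Qed.

Lemma sup_counting_ge0 (R : realType) (T : choiceType) (P : set T -> Prop) :
  P set0 -> 0 <= ereal_sup [set counting S | S in P] :> \bar R.
Proof.
move=> P0; apply: le_ereal_sup_tmp; exists (counting (set0 : set T)).
  by exists set0.
exact: counting_ge0.
Qed.

Lemma sup_counting_le (R : realType) (T : choiceType) (P Q : set T -> Prop) :
  (forall S, P S -> Q S) ->
  ereal_sup [set counting S | S in P] <=
    ereal_sup [set counting S | S in Q] :> \bar R.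
Proof. by move=> PQ; apply: ereal_sup_le => _ [S /PQ QS <-]; exists S. Qed.

(** * Maximal separated sets are spanning *)

(** Zorn's lemma for sets whose distinct points are pairwise related by [D]. *)
Lemma ex_maximal_pairwise (T : Type) (D : T -> T -> Prop) :
  (forall x y, D x y -> D y x) ->
  exists S : set T, (forall x y, S x -> S y -> x <> y -> D x y) /\
    forall x, S x \/ exists2 y, S y & ~ D x y.
Proof.
move=> Dsym.
pose P := [set S : set T | forall x y, S x -> S y -> x <> y -> D x y].
have [|S [PS Smax]] := @Zorn_bigcup T P.
  move=> F FP Ftot x y [A FA Ax] [B FB By] xy.
  have [AB|BA] := Ftot _ _ FA FB.
    exact: (FP _ FB) (AB _ Ax) By xy.
  exact: (FP _ FA) Ax (BA _ By) xy.
exists S; split=> // x; apply: contrapT => /not_orP[nSx nD].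
have Dx y : S y -> D x y.
  by move=> Sy; apply: contrapT => nDxy; apply: nD; exists y.
apply: (Smax (x |` S)).
  split; first by move=> y Sy; right.
  by move=> /(_ x (or_introl erefl)).
move=> y z [->|Sy] [->|Sz] yz //.
- exact: Dx.
- exact/Dsym/Dx.
- exact: PS.
Qed.

Lemma dist_rhoC (R : realType) (T : Type) (d : T -> T -> R) (A B : set T) :
  (forall x y, d x y = d y x) -> dist_rho d A B = dist_rho d B A.
Proof.
move=> dC; rewrite /dist_rho; congr ereal_inf; apply/seteqP.
by split=> _ [x Ax [y By <-]]; exists y => //; exists x => //; rewrite dC.
Qed.

Lemma dist_rho_self (R : realType) (T : Type) (d : T -> T -> R) (A : set T) :
  (forall x, d x x = 0%R) -> A !=set0 -> dist_rho d A A <= 0.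
Proof.
move=> d0 [a Aa]; apply: ge_ereal_inf; exists (d a a)%:E; last by rewrite d0.
by exists a => //; exists a.
Qed.

Lemma mv_iter_nonempty (X : Type) (phi : nat -> X -> set X) k x :
  (forall j x, phi j x !=set0) -> mv_iter phi k x !=set0.
Proof.
move=> phi0; elim: k => [|k [y ky]] /=; first by exists x.
by have [z yz] := phi0 k y; exists z, y.
Qed.

Lemma r_rho_le_s_rho (R : realType) (X : choiceType) (phi : nat -> X -> set X)
    (p : X -> X -> R) e n :
  (forall j x, phi j x !=set0) -> pseudometric p -> (0 < e)%R ->
  r_rho phi p e n <= s_rho phi p e n.
Proof.
move=> phi0 [_ p0 pC _] e0.
have [x y [k [kn exy]]|S [Ssep Smax]] := @ex_maximal_pairwise X (fun x y =>
  exists k, (k < n)%N /\ e%:E < dist_rho p (mv_iter phi k x) (mv_iter phi k y)).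
  by exists k; rewrite dist_rhoC.
apply: (@le_trans _ _ (counting S)).
  apply: ge_ereal_inf; exists (counting S) => //; exists S => // x.
  have [Sx|[y Sy nxy]] := Smax x.
    exists x; split=> // k _; apply: (@le_trans _ _ 0); last by rewrite lee_fin ltW.
    by apply: dist_rho_self => //; exact: mv_iter_nonempty.
  exists y; split=> // k kn; rewrite leNgt; apply/negP => exy.
  by apply: nxy; exists k.
by apply: le_ereal_sup_tmp; exists (counting S) => //; exists S.
Qed.

(** * Infimum distance versus Hausdorff distance *)

Lemma dist_rho_le_hausdorff (R : realType) (T : Type) (d : T -> T -> R)
    (A B : set T) : A !=set0 -> dist_rho d A B <= dist_hausdorff d A B.
Proof.
move=> [a Aa]; rewrite /dist_hausdorff le_max; apply/orP; left.
apply: le_ereal_sup_tmp; exists (ereal_inf [set (d a b)%:E | b in B]).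
  by exists a.
by apply: ereal_inf_le_tmp => _ [b Bb <-]; exists a => //; exists b.
Qed.

Lemma s_rho_le_s_H (R : realType) (X : choiceType) (phi : nat -> X -> set X)
    (p : X -> X -> R) e n :
  (forall j x, phi j x !=set0) -> s_rho phi p e n <= s_H phi p e n.
Proof.
move=> phi0; apply: sup_counting_le => S Ssep x y Sx Sy xy.
have [k [kn exy]] := Ssep x y Sx Sy xy; exists k; split=> //.
by apply: lt_le_trans exy _; exact/dist_rho_le_hausdorff/mv_iter_nonempty.
Qed.

(** * Hausdorff distance of iterates versus branch distance *)

(** A map which does not increase distances does not increase Hausdorff
distances. *)
Lemma dist_hausdorff_image (R : realType) (T T' : Type) (d : T -> T -> R)
    (d' : T' -> T' -> R) (f : T -> T') (A B : set T) :
  (forall x y, (d' (f x) (f y) <= d x y)%R) ->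
  dist_hausdorff d' (f @` A) (f @` B) <= dist_hausdorff d A B.
Proof.
move=> fd; rewrite /dist_hausdorff ge_max !le_max; apply/andP; split.
  apply/orP; left; apply/ereal_supP => _ [_ [a Aa <-] <-].
  apply: le_ereal_sup_tmp; exists (ereal_inf [set (d a b)%:E | b in B]).
    by exists a.
  apply/ereal_infP => _ [b Bb <-]; apply: ge_ereal_inf.
  exists (d' (f a) (f b))%:E; last by rewrite lee_fin.
  by exists (f b) => //; exists b.
apply/orP; right; apply/ereal_supP => _ [_ [b Bb <-] <-].
apply: le_ereal_sup_tmp; exists (ereal_inf [set (d a b)%:E | a in A]).
  by exists b.
apply/ereal_infP => _ [a Aa <-]; apply: ge_ereal_inf.
exists (d' (f a) (f b))%:E; last by rewrite lee_fin.
by exists (f a) => //; exists a.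
Qed.

(** Every point of an iterate lies on an infinite orbit. *)
Lemma ex_orbit_through (X : Type) (phi : nat -> X -> set X) x k a :
  (forall j x, phi j x !=set0) -> mv_iter phi k x a ->
  exists f : nat -> X,
    [/\ f 0%N = x, f k = a & forall i, phi i (f i) (f i.+1)].
Proof.
move=> phi0.
have /choice[c cP] (jy : nat * X) : exists z, phi jy.1 jy.2 z.
  exact: phi0.
elim: k a => [a ->|k IHk a [y /IHk[f [f0 fk fP]] ya]].
  by exists (nat_rect _ x (fun i z => c (i, z))); split=> // i; exact: cP (i, _).
(* The orbit [f] through [y] is kept up to time [k] and rerouted through [a],
   from where it is continued by the choice function [c]. *)
pose g := nat_rect (fun=> X) (f 0%N) (fun i z =>
  if (i < k)%N then f i.+1 else if i == k then a else c (i, z)).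
have gf i : (i <= k)%N -> g i = f i by case: i => //= i ->.
exists g; split; [by []|by rewrite /= ltnn eqxx|move=> i].
have [ik|ki|->] := ltngtP i k.
- by rewrite !gf // ltnW.
- by rewrite /= ltnNge (ltnW ki) /= gtn_eqF //; exact: cP (i, _).
- by rewrite gf // fk /= ltnn eqxx.
Qed.

Lemma orbits_mv_iter (X : Type) (phi : nat -> X -> set X) n x (u : 'I_n -> X)
    (k : 'I_n) : orbits phi x u -> mv_iter phi k x (u k).
Proof.
move=> [u0 uS]; case: k => k; elim: k => [|k IHk] kn /=; first by rewrite u0.
by exists (u (Ordinal (ltnW kn))); [exact: IHk|exact: (uS (Ordinal _))].
Qed.

Lemma mv_iter_orbits (X : Type) (phi : nat -> X -> set X) n x (k : 'I_n) :
  (forall j x, phi j x !=set0) ->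
  mv_iter phi k x = (fun u : 'I_n -> X => u k) @` orbits phi x.
Proof.
move=> phi0; apply/seteqP; split=> [a|_ [u xu <-]]; last exact: orbits_mv_iter.
move=> /(ex_orbit_through _ _ _ _ _ phi0)[f [f0 fk fP]].
by exists (fun i : 'I_n => f i) => //; split=> [i ->|i j ->].
Qed.

Lemma s_H_le_s_branch (R : realType) (X : choiceType) (phi : nat -> X -> set X)
    (p : X -> X -> R) e n :
  (forall j x, phi j x !=set0) -> s_H phi p e n <= s_branch phi p e n.
Proof.
move=> phi0; apply: sup_counting_le => S Ssep x y Sx Sy xy.
have [k [kn]] := Ssep x y Sx Sy xy.
rewrite -[k]/(val (Ordinal kn)) 2?mv_iter_orbits // => /lt_le_trans; apply.
apply: dist_hausdorff_image => u v.
exact: (le_bigmax _ (fun i => p (u i) (v i)) (Ordinal kn)).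
Qed.

Theorem theorem4p17 (R : realType) (X : topologicalType)
  (X_compact : compact [set: X]) (X_hausdorff : hausdorff_space X)
  (U : set (X -> X -> R)) (U_uniformity : uniformity U)
  (U_topology : induces_topology U)
  (phi : nat -> X -> set X)
  (phi_values : forall j x, nonempty_compact (phi j x))
  (phi_usc : forall j, upper_semicontinuous (phi j)) :
  [/\ h_rho_span U phi <= h_rho_sep U phi,
      h_rho_sep U phi <= h_H U phi
    & h_H U phi <= h_branch U phi].
Proof.
have phi0 j x : phi j x !=set0 by have [] := phi_values j x.
split; apply: entropy_of_le => p e n Up e0.
- by apply/ereal_infP => _ [S _ <-]; exact: counting_ge0.
- by apply: r_rho_le_s_rho => //; exact: uniformity_pseudometric Up.
- exact: sup_counting_ge0.
- exact: s_rho_le_s_H.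
- exact: sup_counting_ge0.
- exact: s_H_le_s_branch.
Qed.
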